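(* Let $\theta_1,\dots,\theta_r$ be real numbers, with $d$, $\nu_\theta$ and $H_\theta$ as defined in the context. Let $f_1,\dots,f_D\in\mathbb{C}(X_1,\dots,X_r)$ be real-valued and without pole on $\mathbb{T}^r$, let $F_j(t)=f_j(e^{i\theta_1t},\dots,e^{i\theta_rt})$ for $1\le j\le D$, and let $(G_1(t),\dots,G_D(t))=(F_1(t),\dots,F_D(t))+r(t)$, where $r(t)\in\mathbb{R}^D$ and $r(t)=o(1)$ as $t\to+\infty$. (i) Degenerate case: assume that $\theta_i\in\pi\mathbb{Q}$ for $1\le i\le r$. If there exists $n\in\mathbb{Z}$ such that $F_1(n)>\dots>F_D(n)$, then $0<\underline{\delta}(G_1>\dots>G_D)$; and if there exists $n\in\mathbb{Z}$ such that $F_1(n)\ge\dots\ge F_D(n)$ does not hold, then $\overline{\delta}(G_1>\dots>G_D)<1$. (ii) Non-degenerate case: assume $\theta_i\notin\pi\mathbb{Q}$ for at least one $i\in\{1,\dots,r\}$. If there exist $a\in\{0,\dots,d-1\}$ and $z\in H_\theta$ such that $f_1(\nu_\theta^az)>\dots>f_D(\nu_\theta^az)$, then $0<\underline{\delta}(G_1>\dots>G_D)$. Also, if there exist $a\in\{0,\dots,d-1\}$ and $z\in H_\theta$ such that $f_1(\nu_\theta^az)\ge\dots\ge f_D(\nu_\theta^az)$ does not hold, then $\overline{\delta}(G_1>\dots>G_D)<1$. In particular, if there exists $n\in\mathbb{Z}$ such that $F_1(n)>\dots>F_D(n)$, then $0<\underline{\delta}(G_1>\dots>G_D)$, and if there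 exists $n\in\mathbb{Z}$ such that $F_1(n)\ge\dots\ge F_D(n)$ does not hold, then $\overline{\delta}(G_1>\dots>G_D)<1$.
   Context: $\mathbb{T}=\{z\in\mathbb{C}:|z|=1\}$, and $\mathbb{T}^r$ is a group under coordinatewise multiplication. A rational function has no pole on $\mathbb{T}^r$ if it can be written $P/Q$ with polynomials $P,Q$ such that $Q$ does not vanish on $\mathbb{T}^r$; it is real-valued on $\mathbb{T}^r$ if it takes real values there. $\underline{\delta}(G_1>\dots>G_D)$ and $\overline{\delta}(G_1>\dots>G_D)$ are the $\liminf$ and $\limsup$ as $X\to+\infty$ of $\frac1X\#\{n\in\{1,\dots,X\}:G_1(n)>\dots>G_D(n)\}$. Let $m\ge0$ be defined by $m+1=\dim_{\mathbb{Q}}\mathrm{Span}_{\mathbb{Q}}(\pi,\theta_1,\dots,\theta_r)$. After reindexing the $\theta_i$ (and correspondingly the variables $X_i$), it is assumed that $\{2\pi,\theta_1,\dots,\theta_m\}$ is a basis of this $\mathbb{Q}$-vector space, and one writes $\theta_j=2\pi c_j+\sum_{k=1}^m b_{k,j}\theta_k$ for $m+1\le j\le r$, with $c_j,b_{k,j}\in\mathbb{Q}$. Let $d\ge1$ be the least common multiple of the denominators of all the $c_j$ and $b_{k,j}$ ($d=1$ if $m=r$), $h_{k,j}=d\,b_{k,j}\in\mathbb{Z}$, $\nu_\theta=(e^{i\theta_1},\dots,e^{i\theta_r})$, and $$H_\theta=\left\{\left(z_1^d,\dots,z_m^d,\prod_{k=1}^m z_k^{h_{k,m+1}},\dots,\prod_{k=1}^m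 z_k^{h_{k,r}}\right):(z_1,\dots,z_m)\in\mathbb{T}^m\right\}.$$ *)

(* Defs.v *)
From HB Require Import structures.
From mathcomp Require Import all_boot all_order all_algebra.
From mathcomp Require Import fraction complex.
From mathcomp Require Import (canonicals, coercions) mpoly.
From mathcomp Require Import all_classical all_reals all_analysis.
Set Implicit Arguments.
Unset Strict Implicit.
Unset Printing Implicit Defensive.
Import Order.TTheory GRing.Theory Num.Theory.
Import numFieldNormedType.Exports.
Local Open Scope classical_set_scope.
Local Open Scope ring_scope.

(* The notations of [mpoly] clash with those of the analysis library, hence
   the partial import above and the qualified names below. *)
Definition cpoly (R : realType) (r : nat) := mpoly.mpoly r R[i].

Definition ratfun (R : realType) (r : nat) := {fraction mpoly.mpoly r R[i]}.

Section Torus.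
Variables (R : realType) (r : nat).
Implicit Types (f : ratfun R r) (P Q : cpoly R r) (z : 'I_r -> R[i]).

Definition expi (x : R) : R[i] := Complex (cos x) (sin x).

Definition torus : set ('I_r -> R[i]) := [set z | forall i, `|z i| = 1].

Definition is_quotient f P Q : Prop :=
  f = FracField.tofrac P / FracField.tofrac Q.

Definition no_pole_on_torus f : Prop :=
  exists P Q, is_quotient f P Q /\ (forall z, torus z -> mpoly.meval z Q != 0).

(* The value P(z)/Q(z), for any writing f = P/Q with Q(z) != 0 (it does not
   depend on the writing, see [ratevalE]); 0 if there is no such writing. *)
Definition rateval f z : R[i] :=
  xget 0 [set w | exists P Q, [/\ is_quotient f P Q, mpoly.meval z Q != 0
                                & w = mpoly.meval z P / mpoly.meval z Q]].

Lemma ratevalE f P Q z : is_quotient f P Q -> mpoly.meval z Q != 0 ->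
  rateval f z = mpoly.meval z P / mpoly.meval z Q.
Proof.
move=> fPQ Qz; rewrite /rateval; apply: xget_unique; first by exists P, Q.
move=> _ [P' [Q' [fPQ' Q'z ->]]].
have neq0 (S : cpoly R r) : mpoly.meval z S != 0 -> FracField.tofrac S != 0.
  by rewrite tofrac_eq0; apply: contra_neq => ->; rewrite mpoly.meval0.
have /eqP : FracField.tofrac P' / FracField.tofrac Q' =
            FracField.tofrac P / FracField.tofrac Q by rewrite -fPQ -fPQ'.
rewrite eqr_div ?neq0// -!tofracM tofrac_eq => /eqP E.
by apply/eqP; rewrite eqr_div// -!mpoly.mevalM E.
Qed.

Definition real_on_torus f : Prop :=
  forall z, torus z -> rateval f z \is Num.real.

(* Used only at points where [rateval f z] is real. *)
Definition realval f z : R := complex.Re (rateval f z).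

End Torus.

Section Chains.
Variables (R : realType) (D : nat).

Definition chain_gt (x : 'I_D -> R) : bool :=
  sorted >%R [seq x j | j <- enum 'I_D].
Definition chain_ge (x : 'I_D -> R) : bool :=
  sorted >=%R [seq x j | j <- enum 'I_D].

Definition frequency (A : pred nat) (X : nat) : R :=
  (count A (iota 1 X))%:R / X%:R.

Definition lower_density (A : pred nat) : R := limn_inf (frequency A).
Definition upper_density (A : pred nat) : R := limn_sup (frequency A).

Definition lower_delta (G : 'I_D -> R -> R) : R :=
  lower_density (fun n => chain_gt (G ^~ n%:R)).
Definition upper_delta (G : 'I_D -> R -> R) : R :=
  upper_density (fun n => chain_gt (G ^~ n%:R)).

End Chains.

Section RationalSpan.
Variable R : realType.

Definition Qspan n (x : 'I_n -> R) : set R :=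
  [set y | exists q : 'I_n -> rat, y = \sum_i ratr (q i) * x i].

Definition Qfree n (x : 'I_n -> R) : Prop :=
  forall q : 'I_n -> rat,
    \sum_i ratr (q i) * x i = 0 -> forall i, q i = 0.

Definition Qbasis n (x : 'I_n -> R) (V : set R) : Prop :=
  Qfree x /\ Qspan x = V.

Definition fcons n (a : R) (x : 'I_n -> R) : 'I_n.+1 -> R :=
  fun i => if unlift ord0 i is Some j then x j else a.

Definition in_piQ (x : R) : Prop := exists q : rat, x = pi * ratr q.

End RationalSpan.

Section HTheta.
Variables (R : realType) (r m : nat) (hm : (m <= r)%N).
Variables (c : 'I_r -> rat) (b : 'I_m -> 'I_r -> rat).

(* theta_(m+1), ..., theta_r are the theta j with m <= j; the values c j and
   b k j for j < m play no role here nor below. *)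
Definition theta_relations (theta : 'I_r -> R) : Prop :=
  forall j : 'I_r, (m <= j)%N ->
    theta j = 2 * pi * ratr (c j)
              + \sum_(k < m) ratr (b k j) * theta (widen_ord hm k).

Definition lcm_denom : nat :=
  \big[lcmn/1%N]_(j < r | (m <= j)%N)
    lcmn `|denq (c j)|%N (\big[lcmn/1%N]_(k < m) `|denq (b k j)|%N).

(* d * b_{k,j} is an integer for m <= j, so it equals its numerator. *)
Definition hcoef (k : 'I_m) (j : 'I_r) : int := numq (lcm_denom%:R * b k j).

Definition Htheta : set ('I_r -> R[i]) :=
  [set w | exists z : 'I_m -> R[i], [/\ torus z,
     forall k : 'I_m, w (widen_ord hm k) = z k ^+ lcm_denom &
     forall j : 'I_r, (m <= j)%N -> w j = \prod_(k < m) z k ^ hcoef k j]].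

Definition nu (theta : 'I_r -> R) : 'I_r -> R[i] := fun i => expi (theta i).

End HTheta.

(* Main.v *)
Require Import Defs.
From HB Require Import structures.
From mathcomp Require Import all_boot all_order all_algebra.
From mathcomp Require Import fraction complex.
From mathcomp Require Import (canonicals, coercions) mpoly.
From mathcomp Require Import all_classical all_reals all_analysis.
From mathcomp Require Import ring lra zify.
Set Implicit Arguments.
Unset Strict Implicit.
Unset Printing Implicit Defensive.
Import Order.TTheory GRing.Theory Num.Theory.
Import numFieldNormedType.Exports.
Local Open Scope classical_set_scope.
Local Open Scope ring_scope.

(** The point nu = (e^(i theta_1), ..., e^(i theta_r)) generates a cyclic
    subgroup of the torus, and the F_j are the f_j read along its orbit.  The
    f_j are continuous on the torus, so a strict inequality (or the failure of
    a large one) at a point w of the closure of the orbit persists on a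
    neighbourhood of w, and for large n it also survives the perturbation
    o(1): this is [near_sorted_gt] and [near_unsorted_ge], applied along the
    filter [approach] of the large n with nu^n close to w.

    What remains is that nu^n is close to w for a set of n of positive lower
    density.  This holds for every element of the closure of a cyclic subgroup
    of a compact group: by the pigeonhole principle the times of return near 1
    have bounded gaps ([return_times]), and translating them by one integer n0
    with nu^n0 close to w gives bounded gaps near w ([approach_syndetic]).
    The assertions about an integer n, in particular the degenerate case,
    follow at once, since nu^n lies in the orbit.

    For the points nu^a z with z in H_theta it has to be shown that z is a limit
    of powers of nu^d.  Raised to the power d, the rational relations between
    the theta_j become integral, so nu^(dk) is the image of
    (e^(ik theta_1), ..., e^(ik theta_m)) under the monomial map that
    parametrises H_theta ([expi_exp_lcm_denom]); the claim is then
    Kronecker's theorem for 2 pi, theta_1, ..., theta_m ([kronecker]).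

    Kronecker's theorem is proved by a method of Bohr.  If all v^k stayed away
    from z, then the functions prod_j ((1 + v_j^k / z_j) / 2)^(2p) of k would
    be exponentially small in p, uniformly in k.  Expanding the product gives a
    trigonometric polynomial with distinct frequencies, whose coefficients have
    absolute values bounded by its supremum ([trig_coeff_le]) and adding up to
    1.  There are only (2p+1)^m of them, so 1 would be at most (2p+1)^m q^p for
    some q < 1 and all p, which fails for large p. *)

(** * Sets of integers with bounded gaps and their densities *)

Definition syndetic (A : set nat) : Prop :=
  exists L, forall n, exists2 k, (n <= k < n + L)%N & A k.

(** Each of the disjoint blocks of length L contains an element of A. *)
Lemma count_syndetic (A : pred nat) L :
  (forall n, exists2 k, (n <= k < n + L)%N & A k) ->
  forall s X, (X %/ L <= count A (iota s X))%N.
Proof.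
move=> AL s X; rewrite {2}(divn_eq X L) iotaD count_cat.
apply: leq_trans (leq_addr _ _); elim: (X %/ L)%N s => [//|q IHq] s.
rewrite mulSn iotaD count_cat -add1n leq_add// -has_count.
by have [k nk Ak] := AL s; apply/hasP; exists k; rewrite ?mem_iota.
Qed.

Section Density.
Variable R : realType.
Implicit Type A : pred nat.

Lemma frequency_ge0 A X : 0 <= frequency R A X.
Proof. by rewrite divr_ge0. Qed.

Lemma frequency_le1 A X : frequency R A X <= 1.
Proof.
case: X => [|X]; first by rewrite /frequency invr0 mulr0.
by rewrite ler_pdivrMr ?ltr0n// mul1r ler_nat -[leqRHS](size_iota 1 X.+1) count_size.
Qed.

Lemma lower_density_ge A (c : R) N :
  (forall X, (N <= X)%N -> c <= frequency R A X) -> c <= lower_density R A.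
Proof.
move=> cA; have ub : has_ubound (range (frequency R A)).
  by exists 1 => _ [X _ <-]; exact: frequency_le1.
have lb : has_lbound (range (frequency R A)).
  by exists 0 => _ [X _ <-]; exact: frequency_ge0.
rewrite /lower_density /limn_inf (cvg_lim _ (cvg_infs_sup ub lb))//.
apply: (@le_trans _ _ (infs (frequency R A) N)).
  apply: lb_le_inf; first by exists (frequency R A N), N => /=.
  by move=> _ [X /= NX <-]; exact: cA.
apply: ub_le_sup; last by exists N.
exists 1 => _ [X _ <-]; apply: (le_trans _ (frequency_le1 A X)).
by apply: ge_inf; [exact: has_lbound_sdrop | exists X => /=].
Qed.

Lemma upper_density_le A (c : R) N :
  (forall X, (N <= X)%N -> frequency R A X <= c) -> upper_density R A <= c.
Proof.
move=> cA; have ub : has_ubound (range (frequency R A)).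
  by exists 1 => _ [X _ <-]; exact: frequency_le1.
have lb : has_lbound (range (frequency R A)).
  by exists 0 => _ [X _ <-]; exact: frequency_ge0.
rewrite /upper_density /limn_sup (cvg_lim _ (cvg_sups_inf ub lb))//.
apply: (@le_trans _ _ (sups (frequency R A) N)).
  apply: ge_inf; last by exists N.
  exists 0 => _ [X _ <-]; apply: (le_trans (frequency_ge0 A X)).
  by apply: ub_le_sup; [exact: has_ubound_sdrop | exists X => /=].
apply: ge_sup; first by exists (frequency R A N), N => /=.
by move=> _ [X /= NX <-]; exact: cA.
Qed.

Lemma syndetic_frequency A : syndetic [set n | A n] ->
  exists2 c : R, 0 < c & exists N, forall X, (N <= X)%N -> c <= frequency R A X.
Proof.
case=> L AL; have L0 : (0 < L)%N.
  by have [k] := AL 0%N; case: L {AL} => //; rewrite addn0 ltn0 andbF.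
(* From X on, X / L <= 2 floor (X / L), whence the factor 2. *)
exists (2 * L)%:R^-1; first by rewrite invr_gt0 ltr0n muln_gt0.
exists L => X LX; have X0 : (0 < X)%N by exact: leq_trans LX.
rewrite ler_pdivlMr ?ltr0n// mulrC ler_pdivrMr ?ltr0n ?muln_gt0//.
rewrite -natrM ler_nat; apply: (@leq_trans (X %/ L * (2 * L))).
  rewrite mulnA [(_ * 2)%N]mulnC -mulnA mul2n -addnn {1}(divn_eq X L).
  rewrite leq_add2l; apply: ltnW; apply: leq_trans (ltn_pmod _ L0) _.
  by rewrite leq_pmull// divn_gt0.
by rewrite leq_mul2r count_syndetic ?orbT.
Qed.

Lemma syndetic_lower_density A : syndetic [set n | A n] -> 0 < lower_density R A.
Proof.
by case/syndetic_frequency => c c0 [N cA]; apply: lt_le_trans (lower_density_ge cA).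
Qed.

Lemma syndetic_upper_density A : syndetic [set n | ~~ A n] -> upper_density R A < 1.
Proof.
case/(@syndetic_frequency (predC A)) => c c0 [N cA].
apply: (@le_lt_trans _ _ (1 - c)); last by rewrite ltrBlDr ltrDl.
apply: (@upper_density_le _ _ (maxn N 1)) => X; rewrite geq_max => /andP[NX X0].
rewrite lerBrDr -lerBrDl; apply: le_trans (cA X NX) _.
rewrite lerBrDl /frequency -mulrDl -natrD count_predC size_iota divff//.
by rewrite pnatr_eq0 -lt0n.
Qed.

End Density.

(** * The unit circle *)

Section UnitCircle.
Variable R : realType.
Implicit Types x y : R.

Lemma norm_expz (z : R[i]) (n : int) : `|z| = 1 -> `|z ^ n| = 1.
Proof.
by case: n => n z1; rewrite ?NegzE -?exprnN ?normfV -?exprnP normrX z1 expr1n ?invr1.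
Qed.

Lemma expiD x y : expi (x + y) = expi x * expi y.
Proof. by rewrite /expi cosD sinD [sin x * cos y + _]addrC. Qed.

Lemma expi0 : expi (0 : R) = 1.
Proof. by rewrite /expi cos0 sin0. Qed.

Lemma norm_expi x : `|expi x| = 1.
Proof. by rewrite complex.normc_def /= cos2Dsin2 sqrtr1. Qed.

Lemma expi_neq0 x : expi x != 0.
Proof. by rewrite -normr_gt0 norm_expi. Qed.

Lemma expiMn x n : expi (x * n%:R) = expi x ^+ n.
Proof.
elim: n => [|n IHn]; first by rewrite mulr0 expi0.
by rewrite -[n.+1%:R]natr1 mulrDr mulr1 expiD IHn exprSr.
Qed.

Lemma expiN x : expi (- x) = (expi x)^-1.
Proof.
apply: (mulfI (expi_neq0 x)).
by rewrite divff ?expi_neq0// -expiD subrr expi0.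
Qed.

Lemma expiMz x (n : int) : expi (x * n%:~R) = expi x ^ n.
Proof.
case: n => n; first by rewrite -pmulrn expiMn.
by rewrite NegzE mulrNz mulrN expiN -pmulrn expiMn exprnN.
Qed.

Lemma expi_sum (I : finType) (F : I -> R) : expi (\sum_i F i) = \prod_i expi (F i).
Proof. exact: (big_morph _ expiD expi0). Qed.

Lemma expi_2pi : expi (2 * pi : R) = 1.
Proof. by rewrite mulr_natl /expi cos2pi sin2pi. Qed.

(** Reduced modulo 2 pi, x becomes some y in [0, 2 pi[ with
    1 = cos y = 1 - 2 sin^2 (y/2), whereas sin (y/2) > 0 unless y = 0. *)
Lemma expi_eq1 x : expi x = 1 -> exists n : int, x = 2 * pi * n%:~R.
Proof.
move=> x1; have p0 : 0 < 2 * pi :> R by rewrite mulr_gt0 ?pi_gt0.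
set n := Num.floor (x / (2 * pi)); exists n.
pose y := x - 2 * pi * n%:~R.
have y1 : expi y = 1 by rewrite /y expiD x1 mul1r expiN expiMz expi_2pi exp1rz invr1.
have /andP[n1 n2] := floor_itv (x / (2 * pi)).
have y0 : 0 <= y by rewrite subr_ge0 mulrC -ler_pdivlMr.
have y2 : y < 2 * pi.
  by rewrite ltrBlDr -[X in _ < X + _]mulr1 -mulrDr mulrC -ltr_pdivrMr// addrC -intrD1.
have [yz|yn0] := eqVneq y 0; first by move/eqP: yz; rewrite subr_eq0 => /eqP.
have yp : 0 < y / 2 < pi.
  rewrite divr_gt0//=; last by rewrite lt_def yn0.
  by rewrite ltr_pdivrMr// mulrC.
have := cos_mulr2n (y / 2).
have -> : (y / 2) *+ 2 = y by rewrite -mulr_natr divfK ?pnatr_eq0.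
have -> : cos y = 1 by case: y1.
have := sin_gt0_pi yp; have := cos2Dsin2 (y / 2); nra.
Qed.

End UnitCircle.

(** * Limits along the times at which a sequence approaches a point *)

Section Limits.
Variables (R : realType) (T : Type) (F : set_system T).
Hypothesis FF : Filter F.

Lemma cvg_exprn (u : T -> R[i]^o) (a : R[i]^o) (k : nat) : u t @[t --> F] --> a ->
  ((u t : R[i]) ^+ k : R[i]^o) @[t --> F] --> ((a : R[i]) ^+ k : R[i]^o).
Proof.
move=> ua; elim: k => [|k IHk].
  by under eq_fun do rewrite expr0; rewrite expr0; exact: cvg_cst.
under eq_fun do rewrite exprS; rewrite exprS.
by apply: (@cvgM R[i]); [exact: ua | exact: IHk].
Qed.

Lemma cvg_expz (u : T -> R[i]^o) (a : R[i]^o) (h : int) : a != 0 ->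
  u t @[t --> F] --> a ->
  ((u t : R[i]) ^ h : R[i]^o) @[t --> F] --> ((a : R[i]) ^ h : R[i]^o).
Proof.
move=> a0 ua; case: h => h; first exact: cvg_exprn.
rewrite NegzE; under eq_fun do rewrite -exprnN.
rewrite -exprnN; apply: (@cvgV R[i]); first exact: expf_neq0.
exact: cvg_exprn.
Qed.

Lemma cvg_Re (u : T -> R[i]^o) (a : R[i]^o) :
  u t @[t --> F] --> a -> complex.Re (u t) @[t --> F] --> complex.Re a.
Proof.
move=> /cvgrPdist_lt ua; apply/cvgrPdist_lt => e e0.
have e0' : 0 < (e%:C)%C by rewrite ltcR.
near=> t; have : `|a - u t| < (e%:C)%C by near: t; exact: ua.
rewrite complex.normc_def ltcR; apply: le_lt_trans.
rewrite -raddfB /= -sqrtr_sqr; apply: ler_wsqrtr.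
by rewrite lerDl sqr_ge0.
Unshelve. all: by end_near.
Qed.

End Limits.

Section Approach.
Variables (R : realType) (r : nat).
Variables (x : nat -> 'I_r -> R[i]) (w : 'I_r -> R[i]).

(** The trace on the indices n of the neighbourhoods of (+oo, w): no n is
    required to bring x n close to w, so the filter may be improper. *)
Definition approach : set_system nat :=
  [set A | exists2 e : R[i], 0 < e & exists N, forall n, (N <= n)%N ->
     (forall i, `|x n i - w i| < e) -> A n].

Global Instance approach_filter : Filter approach.
Proof.
split.
- by exists 1 => //; exists 0%N.
- move=> A B [e e0 [N AN]] [e' e'0 [N' BN]].
  have real_e : e \is Num.real by rewrite gtr0_real.
  have real_e' : e' \is Num.real by rewrite gtr0_real.
  exists (Num.min e e'); first by rewrite comparable_lt_min ?e0// real_comparable.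
  exists (maxn N N') => n; rewrite geq_max => /andP[Nn N'n] xw.
  by split; [apply: AN | apply: BN] => // i; move: (xw i);
    rewrite comparable_lt_min ?real_comparable// => /andP[].
- move=> A B AB [e e0 [N AN]]; exists e => //; exists N => n Nn xw.
  by apply/AB/AN.
Qed.

Lemma approach_nbhsoo (A : set nat) : (\forall n \near \oo, A n) -> approach A.
Proof. by case=> N _ NA; exists 1 => //; exists N => n Nn _; exact: NA. Qed.

Lemma cvg_approach i : (x n i : R[i]^o) @[n --> approach] --> (w i : R[i]^o).
Proof.
apply/cvgrPdist_lt => e e0; exists e => //; exists 0%N => n _ /(_ i).
by rewrite distrC.
Qed.

Lemma cvg_meval (P : cpoly R r) :
  (mpoly.meval (x n) P : R[i]^o) @[n --> approach] --> (mpoly.meval w P : R[i]^o).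
Proof.
rewrite [X in _ --> X]mpoly.mevalE.
under eq_fun do rewrite mpoly.mevalE.
apply: (@cvg_big R[i]^o _ +%R) => [|m _]; first exact: add_continuous.
apply: (@cvgM R[i]); first exact: cvg_cst.
apply: (@cvg_big R[i]^o _ *%R) => [|i _]; first exact: mul_continuous.
exact: (cvg_exprn _ (@cvg_approach i)).
Qed.

(** A single quotient P / Q represents f at w and at all the x n. *)
Lemma cvg_realval (f : ratfun R r) : no_pole_on_torus f ->
  (forall n, torus (x n)) -> torus w ->
  realval f (x n) @[n --> approach] --> realval f w.
Proof.
move=> [P [Q [fPQ Q0]]] xT wT.
apply: cvg_Re; rewrite (ratevalE fPQ (Q0 _ wT)).
under eq_fun => n do rewrite (ratevalE fPQ (Q0 _ (xT n))).
apply: (@cvgM R[i]); first exact: cvg_meval.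
by apply: (@cvgV R[i]); [exact: Q0 | exact: cvg_meval].
Qed.

End Approach.

Section SortedLimits.
Variables (R : realType) (T I : Type) (F : set_system T) (FF : Filter F).
Variables (G : I -> T -> R) (x : I -> R).
Hypothesis Gx : forall j, G j t @[t --> F] --> x j.

Lemma near_sorted_gt s : sorted >%R (map x s) ->
  \forall t \near F, sorted >%R (map (G ^~ t) s).
Proof.
elim: s => [|i [|j s] IHs] /=; [by move=> _; near=> t..|].
move=> /andP[xji /IHs Gs]; near=> t; apply/andP; split; last by near: t.
near: t.
have xij : 0 < x i - x j by rewrite subr_gt0.
have : G i t - G j t @[t --> F] --> x i - x j by exact: cvgB.
move=> /(cvgr_gt _)/(_ _ xij); apply: filterS => t.
by rewrite subr_gt0.
Unshelve. all: by end_near.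
Qed.

(** A list that is not decreasing in the large sense has a strict ascent
    between two neighbours, which is an open condition. *)
Lemma near_unsorted_ge s : ~~ sorted >=%R (map x s) ->
  \forall t \near F, ~~ sorted >%R (map (G ^~ t) s).
Proof.
elim: s => [|i [|j s] IHs] //=.
rewrite negb_and -ltNge => /orP[xij|/IHs]; last first.
  by apply: filterS => t Gs; rewrite negb_and Gs orbT.
have xji : 0 < x j - x i by rewrite subr_gt0.
have : G j t - G i t @[t --> F] --> x j - x i by exact: cvgB.
move=> /(cvgr_gt _)/(_ _ xji); apply: filterS => t.
by rewrite subr_gt0 negb_and -leNgt => /ltW->.
Qed.

End SortedLimits.

(** * Recurrence of rotations of the torus *)

Definition orbit_closure (R : realType) (r : nat) (v w : 'I_r -> R[i]) : Prop :=
  forall e : R[i], 0 < e -> exists n : int, forall i, `|v i ^ n - w i| < e.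

Lemma torus_orbit_closure (R : realType) (r : nat) (v w : 'I_r -> R[i]) :
  torus v -> orbit_closure v w -> torus w.
Proof.
move=> v1 vw i; apply/eqP; rewrite eq_sym -subr_eq0 -normr_eq0; apply: contraT => d0.
have /vw[n /(_ i)] : 0 < `|1 - `|w i| | by rewrite lt_def d0 normr_ge0.
rewrite -{1}(norm_expz n (v1 i)) => /lt_le_trans/(_ (ler_dist_dist _ _)).
by rewrite ltxx.
Qed.

(** Every value is first taken before some L common to all the values, as there
    are finitely many of them. *)
Lemma finite_revisit (T : finType) (g : nat -> T) :
  exists L, forall n, exists2 s, (s < L)%N & g s = g n.
Proof.
have first_visit c : exists s, forall n, g n = c -> g s = c.
  have [[s gs]|nex] := pselect (exists s, g s = c); first by exists s.
  by exists 0%N => n gn; case: nex; exists n.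
have [S SP] := choice first_visit.
exists (\max_c S c).+1 => n; exists (S (g n)); last exact: SP.
by rewrite ltnS; exact: leq_bigmax.
Qed.

Lemma truncn_eq_near (R : realType) (a b : R) : 0 <= a -> 0 <= b ->
  Num.trunc a = Num.trunc b -> `|a - b| < 1.
Proof.
move=> /truncn_itv/andP[a1 a2] /truncn_itv/andP[b1 b2] ab.
rewrite ab in a1 a2; rewrite -natr1 in a2 b2.
by rewrite ltr_norml; apply/andP; split; lra.
Qed.

(** The square [-1, 1]^2 is cut along a grid of mesh 1/N; two points of the same
    cell are at distance less than 2/N. *)
Lemma circle_cells (R : realType) (e : R[i]) : 0 < e ->
  exists T : finType, exists cell : R[i] -> T,
    forall z w, `|z| = 1 -> `|w| = 1 -> cell z = cell w -> `|z - w| < e.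
Proof.
move=> e0; set N := (Num.trunc (2 / complex.Re e)).+1.
have eE : (((complex.Re e)%:C)%C : R[i]) = e by rewrite complex.RRe_real// gtr0_real.
have e0' : 0 < complex.Re e by rewrite -ltcR eE.
have N0 : 0 < N%:R :> R by rewrite ltr0n.
have Ne : 2 < complex.Re e * N%:R by rewrite mulrC -ltr_pdivrMr// truncnS_gt.
pose k (a : R) : 'I_(2 * N).+1 := inord (Num.trunc (N%:R * (1 + a))).
exists ('I_(2 * N).+1 * 'I_(2 * N).+1)%type.
exists (fun z => (k (complex.Re z), k (complex.Im z))).
have kP a b : `|a| <= 1 -> `|b| <= 1 -> k a = k b -> `|a - b| < N%:R^-1.
  have bnd (y : R) : `|y| <= 1 -> 0 <= N%:R * (1 + y) < (2 * N).+1%:R.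
    rewrite ler_norml => /andP[y0 y1]; rewrite mulr_ge0 ?(ltW N0)//=; last lra.
    rewrite -natr1 natrM.
    have : N%:R * (1 + y) <= N%:R * 2 by rewrite ler_wpM2l// ?(ltW N0)//; lra.
    lra.
  move=> /bnd/andP[a0 a1] /bnd/andP[b0 b1] /(congr1 val) /=.
  rewrite !inordK ?truncn_lt_nat// => /truncn_eq_near-/(_ a0 b0).
  rewrite -mulrBr normrM (ger0_norm (ltW N0)) -ltr_pdivlMl// mulr1.
  by congr (`|_| < _); ring.
have unit_le (z : R[i]) : `|z| = 1 ->
    `|complex.Re z| <= 1 /\ `|complex.Im z| <= 1.
  rewrite complex.normc_def => -[] /(congr1 (fun y => y ^+ 2)).
  rewrite sqr_sqrtr ?addr_ge0 ?sqr_ge0// expr1n => z1.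
  split; rewrite -(@ler_pXn2r _ 2) ?nnegrE// expr1n real_normK ?num_real// -z1.
    by rewrite lerDl sqr_ge0.
  by rewrite lerDr sqr_ge0.
move=> z w /unit_le[Rz Iz] /unit_le[Rw Iw] [/kP-/(_ Rz Rw) RR /kP-/(_ Iz Iw) II].
have -> : z - w = ((complex.Re z - complex.Re w)%:C + 'i * (complex.Im z - complex.Im w)%:C)%C.
  by rewrite [z - w]complex.complexE !raddfB.
apply: (le_lt_trans (ler_normD _ _)).
have n2 (a : R) : `|(a%:C)%C| = ((`|a|)%:C)%C :> R[i].
  by rewrite complex.normc_def /= expr0n addr0 sqrtr_sqr.
rewrite normrM !n2 [X in _ + X * _]complex.normc_def /= expr0n expr1n add0r sqrtr1 mul1r -eE.
rewrite -rmorphD ltcR.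
have : N%:R^-1 * 2 < complex.Re e by rewrite mulrC ltr_pdivrMr.
lra.
Qed.

Section Recurrence.
Variables (R : realType) (r : nat) (v : 'I_r -> R[i]).
Hypothesis vT : torus v.

(** If v^(n+L) and v^s lie in the same small cell of the torus, with s at most
    L, then v^(n+L-s) is close to 1. *)
Lemma return_times (e : R[i]) : 0 < e ->
  exists L, forall n, exists2 t, (n <= t < n + L)%N & forall i, `|v i ^+ t - 1| < e.
Proof.
move=> /circle_cells[T [cell cellP]].
have [L LP] := finite_revisit (fun n => [ffun i : 'I_r => cell (v i ^+ n)]).
have v1 k i : `|v i ^+ k| = 1 by rewrite normrX vT expr1n.
exists L.+1 => n; have [s sL] := LP (n + L)%N => /ffunP sE.
exists (n + L - s)%N; first lia.
move=> i; have := sE i; rewrite !ffunE => /cellP-/(_ (v1 _ _) (v1 _ _)).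
have -> : v i ^+ (n + L) = v i ^+ (n + L - s) * v i ^+ s by rewrite -exprD; congr (_ ^+ _); lia.
by rewrite -{1}[v i ^+ s]mul1r -mulrBl normrM v1 mulr1 distrC.
Qed.

(** If v^n0 is close to w and v^t is close to 1, then v^(n0+t) is close to w.
    The integer n0 may be negative, so n + |n0| is added to the times t. *)
Lemma approach_syndetic (w : 'I_r -> R[i]) (A : set nat) :
  orbit_closure v w -> approach (fun n i => v i ^+ n) w A -> syndetic A.
Proof.
move=> wcl [e e0 [N NA]].
have e20 : 0 < e / 2 by rewrite divr_gt0.
have [n0 n0w] := wcl _ e20; have [L LP] := return_times e20.
exists (N + L + `|n0| + `|n0|)%N => n.
have [t nt tP] := LP (n + N + `|n0|)%N.
set k := absz (t%:Z + n0); have kE : k%:Z = t%:Z + n0 by rewrite /k; lia.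
exists k; first lia.
apply: NA => [|i]; first lia.
have vi0 : v i != 0 by rewrite -normr_gt0 vT.
have vkE : v i ^+ k = v i ^ n0 * v i ^+ t by rewrite !exprnP kE addrC expfzDr.
have -> : v i ^+ k - w i = v i ^ n0 * (v i ^+ t - 1) + (v i ^ n0 - w i).
  by rewrite vkE mulrBr mulr1 addrA subrK.
rewrite [ltRHS]splitr (le_lt_trans (ler_normD _ _))// ltrD//.
by rewrite normrM norm_expz// mul1r.
Qed.

End Recurrence.

(** * Kronecker's approximation theorem *)

Section Kronecker.
Variable R : realType.
Implicit Types (a q : R).

(** By Bernoulli's inequality q^k is O(1/k), so q^(2k) is O(1/k^2). *)
Lemma geometric_beats_linear a q : 0 <= a -> 0 <= q -> q < 1 ->
  exists l, (a * l%:R + 1) * q ^+ l < 1.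
Proof.
move=> a0 q0 q1; pose h := 1 - q.
have h0 : 0 < h by rewrite subr_gt0.
set k := (Num.trunc (2 * a / h ^+ 2)).+1.
have kP : 2 * a < k%:R * h ^+ 2.
  by rewrite -ltr_pdivrMr ?exprn_gt0// truncnS_gt.
have k0 : 0 < k%:R :> R by rewrite ltr0n.
have qk : q ^+ k * (1 + k%:R * h) <= 1.
  apply: (@le_trans _ _ (q ^+ k * (1 + h) ^+ k)).
    apply: ler_wpM2l; first exact: exprn_ge0.
    elim: (k) => [|n IHn]; first by rewrite mul0r addr0 expr0.
    have h1 : 0 <= 1 + h by rewrite addr_ge0// ltW.
    have := mulr_ge0 (ler0n R n) (sqr_ge0 h).
    have := ler_wpM2l h1 IHn; rewrite [_ ^+ n.+1]exprS -[n.+1%:R]natr1; lra.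
  rewrite -exprMn exprn_ile1//; first by rewrite mulr_ge0// addr_ge0// ltW.
    by have := sqr_ge0 (1 - q); rewrite /h; lra.
exists (2 * k)%N; rewrite mulnC exprM expr2 natrM.
have X0 : 0 <= q ^+ k by exact: exprn_ge0.
set X := q ^+ k in qk X0 *.
have [->|Xn0] := eqVneq X 0; first by rewrite mulr0 mulr0 ltr01.
have Xp : 0 < X by rewrite lt_def Xn0.
have big : a * (k%:R * 2) + 1 < (1 + k%:R * h) ^+ 2 by nra.
apply: (@lt_le_trans _ _ ((1 + k%:R * h) ^+ 2 * (X * X))).
  by rewrite ltr_pM2r// mulr_gt0.
have -> : (1 + k%:R * h) ^+ 2 * (X * X) = (X * (1 + k%:R * h)) ^+ 2 by ring.
by rewrite expr_le1// mulr_ge0// addr_ge0// mulr_ge0// ltW.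
Qed.

(** The coefficient c i is the mean over k of the sum multiplied by (u i)^(-k):
    the other frequencies contribute bounded geometric sums, so the mean over
    k < n differs from c i by O(1/n). *)
Lemma trig_coeff_le (I : finType) (c u : I -> R[i]) (s : R[i]) :
  (forall i, `|u i| = 1) -> injective u ->
  (forall k, `|\sum_i c i * u i ^+ k| <= s) -> forall i, `|c i| <= s.
Proof.
move=> u1 u_inj us i.
have s_real : s \is Num.real by apply/ger0_real/(le_trans _ (us 0%N)).
have u0 j : u j != 0 by rewrite -normr_gt0 u1.
pose B := \sum_(j | j != i) `|c j| * (2 / `|u j / u i - 1|).
have geo y n : y != 1 -> `|y| = 1 -> `|\sum_(k < n) y ^+ k| <= 2 / `|y - 1| :> R[i].
  move=> y1 ny; have y1' : 0 < `|y - 1| by rewrite normr_gt0 subr_eq0.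
  rewrite ler_pdivlMr// -normrM mulrC -subrX1.
  by rewrite (le_trans (ler_normB _ _))// normrX ny expr1n normr1.
(* The sum over k < n of the trigonometric polynomial times (u i)^(-k). *)
have NB n : n%:R * `|c i| <= n%:R * s + B.
  have E : \sum_(k < n) (u i)^-1 ^+ k * \sum_j c j * u j ^+ k
      = n%:R * c i + \sum_(j | j != i) c j * \sum_(k < n) (u j / u i) ^+ k.
    under eq_bigr do rewrite mulr_sumr.
    rewrite exchange_big (bigD1 i)//=; congr (_ + _).
      rewrite (eq_bigr (fun=> c i)) ?sumr_const ?card_ord ?mulr_natl// => k _.
      by rewrite mulrCA -exprMn mulVf// expr1n mulr1.
    apply: eq_bigr => j _; rewrite mulr_sumr; apply: eq_bigr => k _.
    by rewrite mulrCA -exprMn [_^-1 * _]mulrC.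
  have -> : n%:R * `|c i| = `|n%:R * c i| by rewrite normrM normr_nat.
  have -> := esym (addrK (\sum_(j | j != i) c j * \sum_(k < n) (u j / u i) ^+ k) (n%:R * c i)).
  rewrite -E.
  apply: (le_trans (ler_normB _ _)); apply: lerD.
    apply: (le_trans (ler_norm_sum _ _ _)).
    rewrite mulr_natl -[n in leRHS]card_ord -sumr_const.
    apply: ler_sum => k _.
    by rewrite normrM normrX normfV u1 invr1 expr1n mul1r.
  apply: (le_trans (ler_norm_sum _ _ _)); apply: ler_sum => j ji.
  rewrite normrM ler_wpM2l// geo ?normf_div ?u1 ?divr1//.
  apply: contra ji => /eqP ujE; apply/eqP/u_inj.
  by rewrite -[u j](divfK (u0 i)) ujE mul1r.
rewrite real_leNgt ?normr_real//.
apply/negP => sc.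
have B_real : B \is Num.real.
  by apply: sum_real => j _; rewrite realM// realM ?realV ?normr_real.
have [b bE] := complex_realP _ B_real.
have /complex_realP[d dE] : `|c i| - s \is Num.real by rewrite rpredB ?normr_real.
have d0 : 0 < d by rewrite -ltcR -dE subr_gt0.
have := NB (Num.trunc (b / d)).+1.
rewrite -lerBlDl -mulrBr dE bE -(rmorph_nat (real_complex R)) -rmorphM lecR.
by apply/negP; rewrite -ltNge -ltr_pdivrMr// truncnS_gt.
Qed.

(** The parallelogram law for 1 and y: as y leaves 1, the midpoint of 1 and y
    moves inside the disc. *)
Lemma parallelogram1 (y : R[i]) : `|y| = 1 -> `|1 + y| ^+ 2 + `|y - 1| ^+ 2 = 4.
Proof.
move=> y1; have yy : y * y^* = 1 by rewrite -normCK y1 expr1n.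
by rewrite !normCK rmorphD rmorphB rmorph1; ring: yy.
Qed.

(** The hypothesis on [v] says that no character of the torus other than the
    trivial one is trivial at [v]. *)
Lemma kronecker m (v z : 'I_m -> R[i]) :
  torus v -> torus z ->
  (forall g g' : 'I_m -> nat,
     \prod_j v j ^+ g j = \prod_j v j ^+ g' j -> g =1 g') ->
  forall e : R[i], 0 < e -> exists k, forall j, `|v j ^+ k - z j| < e.
Proof.
move=> v1 z1 v_ind e e0; apply: contrapT => far.
have {}far k : exists j, e <= `|v j ^+ k - z j|.
  apply: contrapT => near; apply: far; exists k => j.
  rewrite real_ltNge ?normr_real ?gtr0_real//; apply/negP => ej.
  by apply: near; exists j.
have z0 j : z j != 0 by rewrite -normr_gt0 z1.
pose y k j := v j ^+ k / z j.
have y1 k j : `|y k j| = 1 by rewrite normf_div normrX v1 z1 expr1n divr1.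
pose q := 1 - e ^+ 2 / 4.
have half_le1 k j : `|(1 + y k j) / 2| <= 1.
  rewrite normf_div normr_nat ler_pdivrMr// mul1r.
  by rewrite (le_trans (ler_normD _ _))// y1 normr1.
have half_leq k j : e <= `|v j ^+ k - z j| -> `|(1 + y k j) / 2| ^+ 2 <= q.
  move=> ej; have ey : e <= `|y k j - 1|.
    by rewrite -(divff (z0 j)) -mulrBl normf_div z1 divr1.
  rewrite normf_div normr_nat expr_div_n -natrX ler_pdivrMr//.
  rewrite /q mulrBl mul1r divfK ?pnatr_eq0// -(parallelogram1 (y1 k j)).
  by rewrite lerBrDr lerD2l lerXn2r// nnegrE ltW.
have q0 : 0 <= q.
  by have [j /half_leq] := far 0%N; apply: le_trans; rewrite exprn_ge0.
(* An even exponent, as [half_leq] bounds the square of the factor. *)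
pose n p := (2 * p)%N.
pose c p (g : {ffun 'I_m -> 'I_(n p).+1}) : R[i] :=
  \prod_j ('C(n p, g j)%:R / 2 ^+ n p / z j ^+ g j).
pose u p (g : {ffun 'I_m -> 'I_(n p).+1}) : R[i] := \prod_j v j ^+ g j.
have expand p k : \sum_g c p g * u p g ^+ k = \prod_j ((1 + y k j) / 2) ^+ n p.
  rewrite (eq_bigr (fun j => \sum_(a < (n p).+1)
     ('C(n p, a)%:R / 2 ^+ n p / z j ^+ a) * (v j ^+ a) ^+ k)); last first.
    move=> j _; rewrite exprMn exprDn mulr_suml.
    apply: eq_bigr => a _; rewrite expr1n mul1r /y expr_div_n exprVn -!exprM.
    rewrite [(k * a)%N]mulnC -mulr_natl -!mulrA; congr (_ * _).
    by rewrite mulrC -mulrA mulrCA.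
  rewrite bigA_distr_bigA; apply: eq_bigr => g _.
  by rewrite -prodrXl -big_split.
have u_norm p g : `|u p g| = 1.
  by rewrite normr_prod big1// => j _; rewrite normrX v1 expr1n.
have u_inj p : injective (u p).
  by move=> g g' /v_ind gg'; apply/ffunP => j; apply/val_inj/gg'.
have u_bound p k : `|\sum_g c p g * u p g ^+ k| <= q ^+ p.
  rewrite expand normr_prod; have [j ej] := far k.
  rewrite (bigD1 j)//= -[leRHS]mulr1; apply: ler_pM => //.
  - by apply: prodr_ge0 => i _.
  - by rewrite normrX /n exprM lerXn2r ?nnegrE// ?exprn_ge0// half_leq.
  - by apply: prodr_ile1 => i _; rewrite normr_ge0 normrX exprn_ile1.
have c_norm p g : `|c p g| = \prod_j ('C(n p, g j)%:R / 2 ^+ n p).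
  rewrite normr_prod; apply: eq_bigr => j _.
  by rewrite !normf_div !normrX z1 expr1n divr1 !normr_nat.
have c_sum p : \sum_g `|c p g| = 1.
  under eq_bigr do rewrite c_norm.
  rewrite -(bigA_distr_bigA (fun (j : 'I_m) (a : 'I_(n p).+1) => 'C(n p, a)%:R / 2 ^+ n p)) big1// => j _.
  rewrite -mulr_suml -natr_sum.
  have -> : (\sum_(a < (n p).+1) 'C(n p, a) = 2 ^ n p)%N.
    by rewrite -[2%N]/(1 + 1)%N expnDn; apply: eq_bigr => a _; rewrite !exp1n !muln1.
  by rewrite natrX divff// expf_neq0// pnatr_eq0.
have key p : 1 <= ((n p).+1 ^ m)%:R * q ^+ p.
  rewrite -[leLHS](c_sum p); apply: (@le_trans _ _ (\sum_(g : {ffun 'I_m -> 'I_(n p).+1}) q ^+ p)).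
    by apply: ler_sum => g _; apply: (trig_coeff_le (u_norm p) (u_inj p) (u_bound p)).
  by rewrite sumr_const card_ffun !card_ord mulr_natl.
have [j0 _] := far 0%N.
have m0 : (0 < m)%N by exact: leq_ltn_trans (ltn_ord j0).
have /complex_realP[qR qRE] := ger0_real q0.
have qR0 : 0 <= qR by rewrite -ler0c -qRE.
have qR1 : qR < 1.
  by rewrite -ltcR -qRE rmorph1 ltrBlDr ltrDl divr_gt0// exprn_gt0.
have [l] := geometric_beats_linear (ler0n R (2 * m)) qR0 qR1.
apply/negP; rewrite -leNgt.
(* With p = l m the bound is the m-th power of one that is linear in l. *)
have := key (l * m)%N; rewrite qRE natrX exprM -exprMn.
rewrite -(rmorph_nat (real_complex R)) -rmorphXn -rmorphM -rmorphXn -[1]/(1%:C)%C lecR.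
rewrite expr_ge1// -?lt0n//; last by rewrite mulr_ge0// exprn_ge0.
by rewrite /n [(l * m)%N]mulnC mulnA -natr1 natrM.
Qed.

End Kronecker.

(** * The set H_theta lies in the closure of the orbit *)

Section HthetaClosure.
Variables (R : realType) (r m : nat) (hm : (m <= r)%N).
Variables (c : 'I_r -> rat) (b : 'I_m -> 'I_r -> rat) (theta : 'I_r -> R).

(** If expi (sum_j (g j - g' j) x j) = 1, then sum_j (g j - g' j) x j is an
    integral multiple of 2 pi, and this rational relation has to be trivial. *)
Lemma expi_independent (x : 'I_m -> R) : Qfree (fcons (2 * pi) x) ->
  forall g g' : 'I_m -> nat,
    \prod_j expi (x j) ^+ g j = \prod_j expi (x j) ^+ g' j -> g =1 g'.
Proof.
move=> xfree g g' /eqP.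
have E (h : 'I_m -> nat) : \prod_j expi (x j) ^+ h j = expi (\sum_j x j * (h j)%:R).
  by rewrite expi_sum; apply: eq_bigr => j _; rewrite expiMn.
rewrite !E -subr_eq0 => /eqP/subr0_eq gg'.
have /expi_eq1[n nE] : expi (\sum_j x j * (g j)%:R - \sum_j x j * (g' j)%:R) = 1.
  by rewrite expiD expiN gg' divff ?expi_neq0.
(* The relation of coefficients -n on 2 pi and g j - g' j on x j. *)
pose q (i : 'I_m.+1) : rat :=
  if unlift ord0 i is Some j then (g j)%:R - (g' j)%:R else - n%:~R.
have : \sum_i ratr (q i) * fcons (2 * pi) x i = 0.
  rewrite big_ord_recl /q /fcons unlift_none rmorphN /= ratr_int mulNr mulrC -nE.
  rewrite -sumrB addrC; apply/eqP; rewrite subr_eq0; apply/eqP.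
  apply: eq_bigr => j _; rewrite liftK rmorphB /= !ratr_nat; ring.
move=> /xfree q0 j; have := q0 (lift ord0 j); rewrite /q liftK.
by move/eqP; rewrite subr_eq0 eqr_nat => /eqP.
Qed.

Lemma natr_mul_int (d : nat) (q : rat) :
  (`|denq q| %| d)%N -> d%:R * q = (numq (d%:R * q))%:~R.
Proof.
move=> qd; rewrite numqK//; case/dvdnP: qd => e ->.
rewrite natrM -mulrA rpredM ?natr_int//.
have -> : (`|denq q|%N)%:R = (denq q)%:~R :> rat by rewrite pmulrn gez0_abs.
by rewrite mulrC -numqE intr_int.
Qed.

(** Multiplied by d, the relation of theta j has integral coefficients, and the
    multiple of 2 pi in it is lost under the exponential. *)
Lemma expi_exp_lcm_denom (j : 'I_r) : theta_relations hm c b theta -> (m <= j)%N ->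
  expi (theta j) ^+ lcm_denom c b
  = \prod_(k < m) expi (theta (widen_ord hm k)) ^ hcoef c b k j.
Proof.
move=> rel mj; set d := lcm_denom c b.
have jd : (lcmn `|denq (c j)| (\big[lcmn/1%N]_(k < m) `|denq (b k j)|) %| d)%N.
  exact: (biglcmn_sup j).
have real_int (q : rat) : (`|denq q| %| d)%N ->
    ratr q * d%:R = (numq (d%:R * q))%:~R :> R.
  by move=> /natr_mul_int qd; rewrite -ratr_int -qd rmorphM /= ratr_nat mulrC.
have cd : (`|denq (c j)| %| d)%N by exact: dvdn_trans (dvdn_lcml _ _) jd.
have bd k : (`|denq (b k j)| %| d)%N.
  apply: dvdn_trans jd; apply: dvdn_trans (dvdn_lcmr _ _).
  exact: (biglcmn_sup k).
rewrite -expiMn rel// mulrDl -mulrA real_int// expiD expiMz expi_2pi exp1rz mul1r.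
rewrite mulr_suml expi_sum; apply: eq_bigr => k _.
by rewrite mulrAC real_int// mulrC expiMz.
Qed.

(** Kronecker's theorem gives k with (e^(ik theta_1), ..., e^(ik theta_m)) close
    to the parameter y of z; the monomial map carries this to nu^(dk) close to
    z, and multiplication by nu^a is an isometry. *)
Lemma Htheta_closure (a : nat) (z : 'I_r -> R[i]) :
  Qfree (fcons (2 * pi) (fun k : 'I_m => theta (widen_ord hm k))) ->
  theta_relations hm c b theta -> Htheta hm c b z ->
  orbit_closure (nu theta) (fun i => nu theta i ^+ a * z i).
Proof.
move=> free rel [y [y1 zy zyj]] e e0; set d := lcm_denom c b in zy.
pose v (k : 'I_m) := expi (theta (widen_ord hm k)).
have v1 : torus v by move=> k; exact: norm_expi.
pose x n k := v k ^+ n.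
have cvg_z i :
    ((nu theta i ^+ d) ^+ n : R[i]^o) @[n --> approach x y] --> (z i : R[i]^o).
  have y0 k : y k != 0 by rewrite -normr_gt0 y1.
  have [im|mi] := ltnP i m.
    have -> : i = widen_ord hm (Ordinal im) by exact: val_inj.
    rewrite zy; under eq_fun do rewrite exprAC.
    exact: (cvg_exprn _ (@cvg_approach _ _ x y _)).
  rewrite zyj//.
  under eq_fun => n.
    rewrite expi_exp_lcm_denom// -prodrXl.
    under eq_bigr => k _ do rewrite exprnP exprz_exp mulrC -exprz_exp -exprnP.
    over.
  apply: (@cvg_big R[i]^o _ *%R) => [|k _]; first exact: mul_continuous.
  exact: (cvg_expz _ (y0 k) (@cvg_approach _ _ x y k)).
have : \forall n \near approach x y, forall i, `|z i - (nu theta i ^+ d) ^+ n| < e.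
  by apply: filter_forall => i; move/cvgrPdist_lt: (cvg_z i); exact.
move=> /(approach_syndetic v1) z_times.
have [|L /(_ 0%N)[n _ nP]] := z_times.
  move=> e' e'0; have [n nP] := kronecker v1 y1 (expi_independent free) e'0.
  by exists n => k; exact: nP.
exists (a + d * n)%N => i.
rewrite -exprnP exprD exprM -mulrBr normrM normrX norm_expi expr1n mul1r distrC.
exact: nP.
Qed.

End HthetaClosure.

(** * Frequencies of the orderings *)

Section Perturbation.
Variables (R : realType) (r D : nat) (theta : 'I_r -> R).
Variable f : 'I_D -> ratfun R r.
Hypothesis f_nopole : forall j, no_pole_on_torus (f j).
Variables (F G rem : 'I_D -> R -> R).
Hypothesis F_def : forall j t,
  F j t = realval (f j) (fun i => expi (theta i * t)).
Hypothesis rem_o1 : forall j, rem j t @[t --> +oo] --> (0 : R).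
Hypothesis G_def : forall j t, G j t = F j t + rem j t.

Lemma nu_torus : torus (nu theta).
Proof. by move=> i; exact: norm_expi. Qed.

Lemma nu_expz (n : int) :
  (fun i => expi (theta i * n%:~R)) = (fun i => nu theta i ^ n).
Proof. by apply/funext => i; rewrite expiMz. Qed.

Variables (w : 'I_r -> R[i]).
Hypothesis w_closure : orbit_closure (nu theta) w.
Let orbit n i := nu theta i ^+ n.

Lemma G_cvg j : G j n%:R @[n --> approach orbit w] --> realval (f j) w.
Proof.
under eq_fun do rewrite G_def.
rewrite -[realval _ _]addr0; apply: cvgD.
  have FE n : F j n%:R = realval (f j) (orbit n).
    by rewrite F_def pmulrn nu_expz.
  under eq_fun do rewrite FE.
  apply: cvg_realval => //; last exact: torus_orbit_closure nu_torus w_closure.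
  by move=> n i; rewrite normrX nu_torus expr1n.
have : rem j n%:R @[n --> \oo] --> (0 : R).
  by apply: cvg_comp (rem_o1 j); exact: cvgr_idn.
by move=> rem0 A /rem0; exact: approach_nbhsoo.
Qed.

Lemma lower_delta_gt0 : chain_gt (fun j => realval (f j) w) -> 0 < lower_delta G.
Proof.
move=> fw; apply: syndetic_lower_density.
apply: (approach_syndetic nu_torus w_closure).
exact: (near_sorted_gt _ G_cvg fw).
Qed.

Lemma upper_delta_lt1 : ~ chain_ge (fun j => realval (f j) w) -> upper_delta G < 1.
Proof.
move=> /negP fw; apply: syndetic_upper_density.
apply: (approach_syndetic nu_torus w_closure).
exact: (near_unsorted_ge _ G_cvg fw).
Qed.

End Perturbation.

Theorem proposition3p3 (R : realType) (r D : nat) (theta : 'I_r -> R)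
    (f : 'I_D -> ratfun R r)
    (f_nopole : forall j, no_pole_on_torus (f j))
    (f_real : forall j, real_on_torus (f j))
    (F G rem : 'I_D -> R -> R)
    (F_def : forall j t, F j t = realval (f j) (fun i => expi (theta i * t)))
    (rem_o1 : forall j, rem j t @[t --> +oo] --> (0 : R))
    (G_def : forall j t, G j t = F j t + rem j t) :
  ((forall i, in_piQ (theta i)) ->
     ((exists n : int, chain_gt (F ^~ n%:~R)) -> 0 < lower_delta G) /\
     ((exists n : int, ~ chain_ge (F ^~ n%:~R)) -> upper_delta G < 1))
  /\
  (forall (m : nat) (hm : (m <= r)%N)
          (c : 'I_r -> rat) (b : 'I_m -> 'I_r -> rat),
     Qbasis (fcons (2 * pi) (fun k : 'I_m => theta (widen_ord hm k)))
            (Qspan (fcons pi theta)) ->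
     theta_relations hm c b theta ->
     (exists i, ~ in_piQ (theta i)) ->
     [/\ (exists (a : nat) (z : 'I_r -> R[i]),
            [/\ (a < lcm_denom c b)%N, Htheta hm c b z &
              chain_gt (fun j => realval (f j) (fun i => nu theta i ^+ a * z i))])
         -> 0 < lower_delta G,
         (exists (a : nat) (z : 'I_r -> R[i]),
            [/\ (a < lcm_denom c b)%N, Htheta hm c b z &
              ~ chain_ge (fun j => realval (f j) (fun i => nu theta i ^+ a * z i))])
         -> upper_delta G < 1,
         (exists n : int, chain_gt (F ^~ n%:~R)) -> 0 < lower_delta G &
         (exists n : int, ~ chain_ge (F ^~ n%:~R)) -> upper_delta G < 1]).
Proof.
have F_orbit j (n : int) : F j n%:~R = realval (f j) (fun i => nu theta i ^ n).
  by rewrite F_def nu_expz.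
have orbitP (n : int) : orbit_closure (nu theta) (fun i => nu theta i ^ n).
  by move=> e e0; exists n => i; rewrite subrr normr0.
have lower_orbit : (exists n : int, chain_gt (F ^~ n%:~R)) -> 0 < lower_delta G.
  case=> n; under eq_fun do rewrite F_orbit.
  exact: (lower_delta_gt0 f_nopole F_def rem_o1 G_def).
have upper_orbit : (exists n : int, ~ chain_ge (F ^~ n%:~R)) -> upper_delta G < 1.
  case=> n; under eq_fun do rewrite F_orbit.
  exact: (upper_delta_lt1 f_nopole F_def rem_o1 G_def).
split=> // m hm c b [free _] rel _; split=> //.
  move=> [a [z [_ zH]]]; apply: (lower_delta_gt0 f_nopole F_def rem_o1 G_def).
  exact: Htheta_closure zH.
move=> [a [z [_ zH]]]; apply: (upper_delta_lt1 f_nopole F_def rem_o1 G_def).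
exact: Htheta_closure zH.
Qed.
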